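(* Let $A$ be an abstract algebra, $\mathrm{Rec}(A)$ the Boolean algebra of its recognizable subsets, and $\widehat{A}$ its profinite completion. The assignments $$\Sigma\mapsto \mathcal C_\Sigma=\{L\in \mathrm{Rec}(A)\mid\forall(x,y)\in \Sigma\ (L\in F_y\Rightarrow L\in F_x)\}$$ for $\Sigma\subseteq \widehat{A}\times\widehat{A}$ and $$\mathcal K\mapsto \preceq_{\mathcal K}=\{(x,y)\in \widehat{A}\times\widehat{A}\mid\forall L\in\mathcal K\ (L\in F_y\Rightarrow L\in F_x)\}$$ for $\mathcal K\subseteq \mathrm{Rec}(A)$ establish a Galois connection whose Galois closed sets are the compatible quasiorders on $\widehat{A}$ and the bounded sublattices of $\mathrm{Rec}(A)$, respectively.
   Context: $A$ is an algebra of some (finitary) type $\tau$. A subset $L\subseteq A$ is recognizable if $L=\varphi^{-1}(P)$ for some homomorphism $\varphi:A\to F$ into a finite algebra $F$ of type $\tau$ and some $P\subseteq F$. The profinite completion $\widehat{A}$ is the inverse limit, as a topological algebra, of the finite discrete algebras $A/\theta$, $\theta$ ranging over the congruences of $A$ of finite index. It is identified with the Stone dual space of the Boolean algebra $\mathrm{Rec}(A)$: the point $x=(x_\theta)_\theta\in\widehat A$ corresponds to the prime filter $F_x$ of $\mathrm{Rec}(A)$ such that, for $L=q_\theta^{-1}(P)$ with $q_\theta:A\to A/\theta$ the quotient map and $P\subseteq A/\theta$, $L\in F_x\iff x_\theta\in P$. Write $\eta(L)=\{x\in\widehat A\mid L\in F_x\}$. A quasiorder (reflexive transitive relation) $\preceq$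 on $\widehat{A}$ is compatible if for all $x,y\in\widehat A$ with $x\not\preceq y$ there is $L\in\mathrm{Rec}(A)$ with $L\in F_y$, $L\notin F_x$, and $\eta(L)$ a $\preceq$-down-set. A bounded sublattice of $\mathrm{Rec}(A)$ is a subset containing $\emptyset$ and $A$ and closed under binary union and intersection. *)

(* Defs.v *)
From HB Require Import structures.
From mathcomp Require Import all_boot.
From mathcomp Require Import all_classical topology function_spaces.

Set Implicit Arguments.
Unset Strict Implicit.
Unset Printing Implicit Defensive.

Local Open Scope classical_set_scope.
Local Open Scope quotient_scope.

(* Finitary types and their algebras; carriers may be empty. *)
Record signature := Signature { symbol : Type; arity : symbol -> nat }.

Record algebra (tau : signature) := Algebra {
  carrier :> Type;
  op : forall f : symbol tau, ('I_(arity f) -> carrier) -> carrier }.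
Arguments op {tau} a f _ : rename.

Section Algebras.
Variable tau : signature.

Definition homomorphism (A B : algebra tau) (phi : A -> B) : Prop :=
  forall (f : symbol tau) (a : 'I_(arity f) -> A),
    phi (op A f a) = op B f (phi \o a).

Definition finite_algebra (A : algebra tau) : Prop := finite_set [set: A].

Definition recognizable (A : algebra tau) (L : set A) : Prop :=
  exists (F : algebra tau) (phi : A -> F) (P : set F),
    [/\ finite_algebra F, homomorphism phi & L = phi @^-1` P].

Definition Rec (A : algebra tau) : set (set A) := [set L | recognizable L].
Arguments Rec : clear implicits.

(* [{classic A}] is [A] with the choice structure that generic quotients
   require; by classical logic every relation on [A] is boolean. *)
Record congruence (A : algebra tau) := Congruence {
  cong_rel :> equiv_rel {classic A};
  congP : forall (f : symbol tau) (a b : 'I_(arity f) -> A),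
    (forall i, cong_rel (a i) (b i)) -> cong_rel (op A f a) (op A f b) }.

Definition quotient_alg (A : algebra tau) (theta : congruence A) :
    algebra tau :=
  @Algebra tau {eq_quot theta}
    (fun f c => \pi_{eq_quot theta} (op A f (fun i => repr (c i)))).

Definition quotient_map (A : algebra tau) (theta : congruence A) (a : A) :
    quotient_alg theta := \pi_{eq_quot theta} (a : {classic A}).

Lemma quotient_mapP (A : algebra tau) (theta : congruence A) (a b : A) :
  quotient_map theta a = quotient_map theta b <-> theta a b.
Proof. by split=> /eqmodP. Qed.

Lemma quotient_map_surj (A : algebra tau) (theta : congruence A)
  (c : quotient_alg theta) : exists a, quotient_map theta a = c.
Proof. by exists (repr (c : {eq_quot theta})); exact: reprK. Qed.

Lemma quotient_map_hom (A : algebra tau) (theta : congruence A) :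
  homomorphism (quotient_map theta).
Proof.
move=> f a; apply/quotient_mapP; apply: congP => i.
by apply/quotient_mapP; rewrite /quotient_map reprK.
Qed.

(* The canonical map between quotients; it is only used when [theta] is
   contained in [theta'], where it does not depend on the representative
   (see [transitionE]). *)
Definition transition (A : algebra tau) (theta theta' : congruence A)
    (c : quotient_alg theta) : quotient_alg theta' :=
  quotient_map theta' (repr (c : {eq_quot theta})).

Lemma transitionE (A : algebra tau) (theta theta' : congruence A) (a : A) :
  (forall b c, theta b c -> theta' b c) ->
  transition theta' (quotient_map theta a) = quotient_map theta' a.
Proof.
move=> sub; apply/quotient_mapP; apply: sub.
by apply/quotient_mapP; rewrite /quotient_map reprK.
Qed.

Lemma transition_hom (A : algebra tau) (theta theta' : congruence A) :
  (forall b c, theta b c -> theta' b c) ->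
  homomorphism (@transition A theta theta').
Proof.
move=> sub f c; rewrite {1}/transition -quotient_map_hom; apply/quotient_mapP.
by apply: sub; apply/quotient_mapP; rewrite /quotient_map reprK.
Qed.

Record fin_congruence (A : algebra tau) := FinCongruence {
  fin_cong :> congruence A;
  fin_index : finite_algebra (quotient_alg fin_cong) }.

Definition fin_product (A : algebra tau) : Type :=
  forall theta : fin_congruence A, quotient_alg theta.

Definition coherent (A : algebra tau) (x : fin_product A) : Prop :=
  forall theta theta' : fin_congruence A,
    (forall a b, theta a b -> theta' a b) ->
    transition theta' (x theta) = x theta'.

Definition inverse_limit (A : algebra tau) : Type :=
  {x : fin_product A | coherent x}.

Definition inverse_limit_op (A : algebra tau) (f : symbol tau)
    (x : 'I_(arity f) -> inverse_limit A) : fin_product A :=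
  fun theta => op (quotient_alg theta) f (fun i => sval (x i) theta).

Lemma inverse_limit_op_coherent (A : algebra tau) (f : symbol tau)
  (x : 'I_(arity f) -> inverse_limit A) : coherent (inverse_limit_op x).
Proof.
move=> theta theta' sub; rewrite /inverse_limit_op transition_hom//.
by congr (op _ _ _); apply/funext => i /=; exact: (svalP (x i)).
Qed.

Definition profinite (A : algebra tau) : algebra tau :=
  @Algebra tau (inverse_limit A)
    (fun f x => exist _ (inverse_limit_op x) (inverse_limit_op_coherent x)).

Definition discrete_quotient (A : algebra tau) (theta : fin_congruence A) :
    topologicalType :=
  discrete_topology {classic (quotient_alg theta)}.

Definition to_product (A : algebra tau) (x : inverse_limit A) :
  prod_topology (@discrete_quotient A) := sval x.

HB.instance Definition _ (A : algebra tau) :=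
  Choice.copy (inverse_limit A) {classic (inverse_limit A)}.
HB.instance Definition _ (A : algebra tau) :=
  Topological.copy (inverse_limit A) (initial_topology (@to_product A)).

(* The prime filter [F_x] of [Rec A]. *)
Definition point_filter (A : algebra tau) (x : profinite A) : set (set A) :=
  [set L | exists (theta : fin_congruence A) (P : set (quotient_alg theta)),
     L = quotient_map theta @^-1` P /\ P (sval x theta)].

Definition eta (A : algebra tau) (L : set A) : set (profinite A) :=
  [set x | point_filter x L].

Definition quasiorder (X : Type) (R : set (X * X)) : Prop :=
  (forall x, R (x, x)) /\ (forall x y z, R (x, y) -> R (y, z) -> R (x, z)).

(* [R (x, y)] reads "x below y". *)
Definition down_set (X : Type) (R : set (X * X)) (D : set X) : Prop :=
  forall x y, R (x, y) -> D y -> D x.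

Definition compatible_quasiorder (A : algebra tau)
    (R : set (profinite A * profinite A)) : Prop :=
  quasiorder R /\
  forall x y, ~ R (x, y) ->
    exists2 L, Rec A L &
      [/\ point_filter y L, ~ point_filter x L & down_set R (eta L)].

Definition bounded_sublattice (A : algebra tau) (K : set (set A)) : Prop :=
  [/\ K `<=` Rec A, K set0, K setT,
      forall L M, K L -> K M -> K (L `|` M) &
      forall L M, K L -> K M -> K (L `&` M)].

Definition lattice_of (A : algebra tau)
    (S : set (profinite A * profinite A)) : set (set A) :=
  [set L | Rec A L /\
     forall x y, S (x, y) -> point_filter y L -> point_filter x L].

Definition quasiorder_of (A : algebra tau) (K : set (set A)) :
    set (profinite A * profinite A) :=
  [set p | forall L, K L -> point_filter p.2 L -> point_filter p.1 L].

End Algebras.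
Arguments Rec {tau} A _.

Section Checks.
Variables (tau : signature) (A : algebra tau).

Definition kernel_rel (F : algebra tau) (phi : A -> F) :
  rel {classic A} := fun a b => `[< phi a = phi b >].

Lemma kernel_refl (F : algebra tau) (phi : A -> F) : reflexive (kernel_rel phi).
Proof. by move=> a; apply/asboolP. Qed.

Lemma kernel_sym (F : algebra tau) (phi : A -> F) : symmetric (kernel_rel phi).
Proof. by move=> a b; apply/asboolP/asboolP. Qed.

Lemma kernel_trans (F : algebra tau) (phi : A -> F) : transitive (kernel_rel phi).
Proof. by move=> b a c /asboolP ab /asboolP bc; apply/asboolP; rewrite ab. Qed.

Definition kernel_equiv (F : algebra tau) (phi : A -> F) : equiv_rel {classic A} :=
  EquivRel (kernel_rel phi) (kernel_refl phi) (kernel_sym phi)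
    (@kernel_trans F phi).

Lemma kernel_congP (F : algebra tau) (phi : A -> F) : homomorphism phi ->
  forall (f : symbol tau) (a b : 'I_(arity f) -> A),
    (forall i, kernel_equiv phi (a i) (b i)) ->
    kernel_equiv phi (op A f a) (op A f b).
Proof.
move=> hphi f a b ab; apply/asboolP; rewrite !hphi; congr (op _ _ _).
by apply/funext => i /=; apply/asboolP/ab.
Qed.

Lemma RecP (L : set A) : Rec A L <->
  exists (theta : fin_congruence A) (P : set (quotient_alg theta)),
    L = quotient_map theta @^-1` P.
Proof.
split=> [[F [phi [P [finF hphi ->]]]]|[theta [P ->]]]; last first.
  exists (quotient_alg theta), (quotient_map theta), P.
  by split=> //; [exact: fin_index|exact: quotient_map_hom].
pose theta := Congruence (kernel_congP hphi).
pose g (c : quotient_alg theta) : F := phi (repr (c : {eq_quot theta})).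
have gq a : g (quotient_map theta a) = phi a.
  have /quotient_mapP/asboolP// : quotient_map theta
    (repr (quotient_map theta a : {eq_quot theta})) = quotient_map theta a.
  by rewrite /quotient_map reprK.
have ginj : injective g.
  move=> c d; have [a <-] := quotient_map_surj c.
  have [b <-] := quotient_map_surj d.
  by rewrite !gq => ab; apply/quotient_mapP/asboolP.
have fin_theta : finite_algebra (quotient_alg theta).
  rewrite /finite_algebra -(preimage_setT g).
  by apply: finite_preimage => // c d _ _; exact: ginj.
exists (FinCongruence fin_theta), (g @^-1` P).
by apply/seteqP; split=> a /=; rewrite gq.
Qed.

Definition meet_rel (theta theta' : congruence A) : rel {classic A} :=
  fun a b => theta a b && theta' a b.

Lemma meet_refl theta theta' : reflexive (meet_rel theta theta').
Proof. by move=> a; rewrite /meet_rel !equiv_refl. Qed.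

Lemma meet_sym theta theta' : symmetric (meet_rel theta theta').
Proof.
by move=> a b; rewrite /meet_rel (equiv_sym theta) (equiv_sym theta').
Qed.

Lemma meet_trans theta theta' : transitive (meet_rel theta theta').
Proof.
move=> b a c /andP[ab ab'] /andP[bc bc'].
by rewrite /meet_rel (equiv_trans ab bc) (equiv_trans ab' bc').
Qed.

Definition meet_equiv theta theta' : equiv_rel {classic A} :=
  EquivRel (meet_rel theta theta') (meet_refl theta theta')
    (meet_sym theta theta') (@meet_trans theta theta').

Lemma meet_congP (theta theta' : congruence A)
  (f : symbol tau) (a b : 'I_(arity f) -> A) :
  (forall i, meet_equiv theta theta' (a i) (b i)) ->
  meet_equiv theta theta' (op A f a) (op A f b).
Proof. by move=> ab; apply/andP; split; apply: congP => i; case/andP: (ab i). Qed.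

Definition meet_cong theta theta' := Congruence (@meet_congP theta theta').

Lemma meet_fin (theta theta' : fin_congruence A) :
  finite_algebra (quotient_alg (meet_cong theta theta')).
Proof.
set mu := meet_cong _ _.
pose g (c : quotient_alg mu) :=
  (transition theta c, transition theta' c).
have sub a b : mu a b -> theta a b by case/andP.
have sub' a b : mu a b -> theta' a b by case/andP.
have ginj : injective g.
  move=> c d; have [a <-] := quotient_map_surj c.
  have [b <-] := quotient_map_surj d; rewrite /g !transitionE//.
  by case=> /quotient_mapP ab /quotient_mapP ab'; apply/quotient_mapP/andP.
have fin2 : finite_set [set: quotient_alg theta * quotient_alg theta'].
  by rewrite -setXTT; apply: finite_setX; exact: fin_index.
rewrite /finite_algebra -(preimage_setT g).
by apply: finite_preimage => // c d _ _; exact: ginj.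
Qed.

Lemma common_representative (x : profinite A) (theta theta' : fin_congruence A) :
  exists a, sval x theta = quotient_map theta a /\
            sval x theta' = quotient_map theta' a.
Proof.
pose mu := FinCongruence (@meet_fin theta theta').
have [a xa] := quotient_map_surj (sval x mu); exists a.
by split; rewrite -(svalP x mu) -?xa ?transitionE// => b c /andP[].
Qed.

(* [point_filter] does not depend on the presentation of the recognizable
   set as a preimage. *)
Lemma point_filterE (x : profinite A) (theta : fin_congruence A)
  (P : set (quotient_alg theta)) :
  point_filter x (quotient_map theta @^-1` P) <-> P (sval x theta).
Proof.
split=> [|Px]; last by exists theta, P.
move=> [theta' [Q [eqPQ]]].
have [a [-> ->]] := common_representative x theta theta' => Qa.
by have : (quotient_map theta' @^-1` Q) a by []; rewrite -eqPQ.
Qed.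

End Checks.

(* Main.v *)
Require Import Defs.
From mathcomp Require Import all_boot.
From mathcomp Require Import all_classical.

(** Both assignments come from the single relation between pairs [(x, y)] of
    points and recognizable sets [L] saying that [L \in F_y] implies
    [L \in F_x], so they form a Galois connection for formal reasons; what has
    to be found are the closed sets.

    On the side of relations this is again formal.  A relation of the form
    [quasiorder_of K] is a quasiorder, and since membership in [lattice_of S]
    says exactly that [eta L] is a down-set for [S], compatibility of a
    quasiorder [S] is the inclusion of [quasiorder_of (lattice_of S)] in [S].

    On the side of lattices, [lattice_of S] is a bounded sublattice because
    every [F_x] is a prime filter of [Rec A] ([point_filterU],
    [point_filterI]).  The converse is where compactness of the profinite
    completion enters, in the form of [filter_point]: every proper filter on
    the underlying set of [A] has a cluster point, that is, a point [x] such
    that [F_x] contains the recognizable members of the filter.  Given a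
    bounded sublattice [K] and a recognizable [L] outside [K], the argument of
    the prime filter theorem for distributive lattices is run twice.  The sets
    [L `\` M], for [M \in K] contained in [L], form a proper filter base
    because [L \notin K]; if [y] is a cluster point, then [F_y] contains [L]
    but no member of [K] included in [L].  Hence the sets [M `\` L], for
    [M \in K] with [M \in F_y], form a proper filter base as well, and any
    cluster point [x] satisfies [L \notin F_x] and lies below [y] in
    [quasiorder_of K].  The pair [(x, y)] then shows that [L] is not Galois
    closed ([bounded_sublattice_separation]). *)

Local Open Scope classical_set_scope.

(** * The prime filters of recognizable sets *)

Section PointFilters.
Context {tau : signature} {A : algebra tau}.
Implicit Types (L M : set A) (x : profinite A) (theta : fin_congruence A).

(** This reduces the Boolean operations on [Rec A] to those on the powerset of
    one finite quotient. *)
Lemma common_presentation L M : Rec A L -> Rec A M ->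
  exists theta (P Q : set (quotient_alg theta)),
    L = quotient_map theta @^-1` P /\ M = quotient_map theta @^-1` Q.
Proof.
move=> /RecP[theta [P ->]] /RecP[theta' [Q ->]].
pose mu := FinCongruence (@meet_fin _ _ theta theta').
exists mu, (transition theta @^-1` P), (transition theta' @^-1` Q).
by split; apply/seteqP; split=> a /=; rewrite transitionE// => b c /andP[].
Qed.

Lemma RecU L M : Rec A L -> Rec A M -> Rec A (L `|` M).
Proof.
move=> RL RM; have [theta [P [Q [-> ->]]]] := common_presentation _ _ RL RM.
by apply/RecP; exists theta, (P `|` Q).
Qed.

Lemma RecI L M : Rec A L -> Rec A M -> Rec A (L `&` M).
Proof.
move=> RL RM; have [theta [P [Q [-> ->]]]] := common_presentation _ _ RL RM.
by apply/RecP; exists theta, (P `&` Q).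
Qed.

Let one_element : algebra tau := @Algebra tau unit (fun _ _ => tt).

(** The constant predicate [P] stands for both [set0] and [setT], to which
    [[set _ | P]] is convertible when [P] is [False] or [True]. *)
Lemma Rec_const (P : Prop) : Rec A [set _ | P].
Proof.
exists one_element, (fun=> tt), [set _ | P]; split=> //.
exact: finite_finset.
Qed.

Lemma point_filter_const x (P : Prop) : point_filter x [set _ | P] <-> P.
Proof.
have /RecP[theta _] := Rec_const P.
exact: (point_filterE x (theta := theta) [set _ | P]).
Qed.

Lemma point_filterU x L M : Rec A L -> Rec A M ->
  point_filter x (L `|` M) <-> point_filter x L \/ point_filter x M.
Proof.
move=> RL RM; have [theta [P [Q [-> ->]]]] := common_presentation _ _ RL RM.
by rewrite -preimage_setU !point_filterE.
Qed.

Lemma point_filterI x L M : Rec A L -> Rec A M ->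
  point_filter x (L `&` M) <-> point_filter x L /\ point_filter x M.
Proof.
move=> RL RM; have [theta [P [Q [-> ->]]]] := common_presentation _ _ RL RM.
by rewrite -preimage_setI !point_filterE.
Qed.

End PointFilters.

(** * Compactness of the profinite completion *)

(** Otherwise the complements of the fibres all belong to the ultrafilter, and
    so does their intersection, which is empty. *)
Lemma ultrafilter_fibre {T U : Type} {F : set_system T} (f : T -> U) :
  UltraFilter F -> finite_set [set: U] -> exists u, F (f @^-1` [set u]).
Proof.
move=> UF /(@finite_fsetP {classic U})[D UD]; apply: contrapT => nofibre.
have FC : F (\bigcap_(u in [set: U]) ~` (f @^-1` [set u])).
  rewrite UD; apply: (@filter_bigI _ {classic U}) => u _.
  have [Fu|//] := in_ultra_setVsetC (f @^-1` [set u]) UF.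
  by case: nofibre; exists u.
by have [a /(_ (f a) I) []] := filter_ex FC.
Qed.

Section Limits.
Context {tau : signature} {A : algebra tau}.

(** The coordinate of the point at [theta] is the class that belongs to the
    ultrafilter; coordinates are coherent since members of an ultrafilter
    intersect. *)
Lemma ultrafilter_point (F : set_system A) : UltraFilter F ->
  exists x : profinite A, forall L, Rec A L -> (point_filter x L <-> F L).
Proof.
move=> UF.
have fibre (theta : fin_congruence A) :=
  cid (ultrafilter_fibre (quotient_map theta) UF (fin_index theta)).
pose x : fin_product A := fun theta => sval (fibre theta).
have Fx (theta : fin_congruence A) : F (quotient_map theta @^-1` [set x theta]).
  exact: svalP (fibre theta).
have xc : coherent x.
  move=> theta theta' sub.
  by have [a [/= <- <-]] := filter_ex (filterI (Fx theta) (Fx theta'));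
     exact: transitionE.
exists (exist _ x xc) => _ /RecP[theta [P ->]]; rewrite point_filterE /=.
split=> [Px|FP]; first by apply: filterS (Fx theta) => a /= ->.
by have [a [/= <-]] := filter_ex (filterI (Fx theta) FP).
Qed.

(** Existence of cluster points: any ultrafilter refining [G] determines one. *)
Lemma filter_point (G : set_system A) : ProperFilter G ->
  exists x : profinite A, forall L, Rec A L ->
    (G L -> point_filter x L) /\ (G (~` L) -> ~ point_filter x L).
Proof.
move=> /ultraFilterLemma[F [UF GF]].
have [x Fx] := ultrafilter_point F UF; exists x => L RL.
split=> [GL|GCL]; first by apply/Fx => //; exact: GF.
move=> /Fx-/(_ RL) FL.
by have [a []] := filter_ex (filterI FL (GF _ GCL)).
Qed.

End Limits.

(** * The Galois closed sets *)

Section GaloisClosed.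
Context {tau : signature} {A : algebra tau}.
Implicit Types (S : set (profinite A * profinite A)) (K : set (set A)).

Lemma quasiorder_of_quasiorder K : quasiorder (quasiorder_of K).
Proof. by split=> [x L|x y z xy yz L KL /(yz L KL)]; [|exact: xy]. Qed.

Lemma lattice_of_bounded_sublattice S : bounded_sublattice (lattice_of S).
Proof.
split.
- by move=> L [].
- by split=> [|x y _]; [exact: Rec_const|rewrite !point_filter_const].
- by split=> [|x y _]; [exact: Rec_const|rewrite !point_filter_const].
- move=> L M [RL SL] [RM SM]; split=> [|x y Sxy]; first exact: RecU.
  by rewrite !point_filterU// => -[/(SL _ _ Sxy)|/(SM _ _ Sxy)]; [left|right].
- move=> L M [RL SL] [RM SM]; split=> [|x y Sxy]; first exact: RecI.
  by rewrite !point_filterI// => -[/(SL _ _ Sxy) ? /(SM _ _ Sxy)].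
Qed.

Lemma quasiorder_of_lattice_ofP S :
  quasiorder_of (lattice_of S) = S <-> compatible_quasiorder S.
Proof.
split=> [SE|[_ Scomp]].
  split=> [|x y]; first by rewrite -SE; exact: quasiorder_of_quasiorder.
  rewrite -{1}SE => /existsNP[L /not_implyP[[RL SL] /not_implyP[yL xL]]].
  by exists L.
apply/seteqP; split=> [[x y] Sxy|[x y] Sxy L [_ SL]]; last exact: SL.
apply: contrapT => /Scomp[L RL [yL xL SL]].
by apply: xL; apply: Sxy yL; split=> // u v; exact: SL.
Qed.

(** The order of the choices matters: [y] is taken first, so as to contain [L]
    but no member of [K] included in [L]; only then is [x] required to contain
    the members of [K] in [F_y] and to avoid [L]. *)
Lemma bounded_sublattice_separation K L :
  bounded_sublattice K -> Rec A L -> ~ K L ->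
  exists x y : profinite A,
    [/\ quasiorder_of K (x, y), point_filter y L & ~ point_filter x L].
Proof.
move=> [KR K0 KT KU KI] RL nKL.
pose G := filter_from [set M | K M /\ M `<=` L] (fun M => L `\` M).
have PG : ProperFilter G.
  apply: filter_from_proper => [|M [KM ML]]; last first.
    apply: contrapT => /nonemptyPn; rewrite setD_eq0 => LM; apply: nKL.
    by have -> : L = M by apply/seteqP; split.
  apply: filter_from_filter => [|M N [KM ML] [KN NL]].
    by exists set0; split; last exact: sub0set.
  exists (M `|` N); last by rewrite setDUr.
  by split; [exact: KU|rewrite subUset].
have [y Gy] := filter_point G PG.
have yL : point_filter y L.
  by apply: (Gy L RL).1; exists set0; [split; last exact: sub0set|exact: subDsetl].
have yNK M : K M -> M `<=` L -> ~ point_filter y M.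
  by move=> KM ML; apply: (Gy M (KR _ KM)).2; exists M => // a [].
pose H := filter_from [set M | K M /\ point_filter y M] (fun M => M `\` L).
have PH : ProperFilter H.
  apply: filter_from_proper => [|M [KM yM]]; last first.
    by apply: contrapT => /nonemptyPn; rewrite setD_eq0 => ML; exact: yNK yM.
  apply: filter_from_filter => [|M N [KM yM] [KN yN]].
    by exists setT; split=> //; exact/point_filter_const.
  exists (M `&` N); last by move=> a [[]].
  by split; [exact: KI|apply/point_filterI => //; exact: KR].
have [x Hx] := filter_point H PH.
exists x, y; split=> // [M KM yM|].
  by apply: (Hx M (KR _ KM)).1; exists M => // a [].
apply: (Hx L RL).2; exists setT; last by move=> a [].
by split=> //; exact/point_filter_const.
Qed.

Lemma lattice_of_quasiorder_ofP K :
  lattice_of (quasiorder_of K) = K <-> bounded_sublattice K.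
Proof.
split=> [<-|Kl]; first exact: lattice_of_bounded_sublattice.
have [KR _ _ _ _] := Kl.
apply/seteqP; split=> [L [RL KL]|L KL]; last first.
  by split=> [|x y]; [exact: KR|exact].
apply: contrapT => /(bounded_sublattice_separation _ _ Kl RL)[x [y [xy yL]]].
by apply; exact: KL xy yL.
Qed.

End GaloisClosed.

Theorem theorem4p7 (tau : signature) (A : algebra tau) :
  [/\ (* antitone Galois connection between the two powersets *)
      forall (S : set (profinite A * profinite A)) (K : set (set A)),
        K `<=` Rec A ->
        (K `<=` lattice_of S <-> S `<=` quasiorder_of K),
      forall S : set (profinite A * profinite A),
        quasiorder_of (lattice_of S) = S <-> compatible_quasiorder S
    & forall K : set (set A), K `<=` Rec A ->
        (lattice_of (quasiorder_of K) = K <-> bounded_sublattice K)].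
Proof.
split=> [S K KR|S|K _].
- split=> [KS [x y] Sxy L /KS[_ SL]|SK L KL]; first exact: SL.
  by split=> [|x y /SK]; [exact: KR|exact].
- exact: quasiorder_of_lattice_ofP.
- exact: lattice_of_quasiorder_ofP.
Qed.
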